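(* Let $(X,d)$ be an unbounded metric space. For $q\in X^\#$, we have $q\in \mathrm{cl}\, K(X^\#)$ if and only if each $Q\in q$ is prethick.
   Context: For $x\in X$, $r\geqslant 0$, $A\subseteq X$: $B(x,r)=\{y\in X: d(x,y)\leqslant r\}$ and $B(A,r)=\bigcup_{a\in A}B(a,r)$. A subset $V\subseteq X$ is bounded if $V\subseteq B(x,r)$ for some $x\in X$, $r\geqslant 0$. A subset $Y\subseteq X$ is thick if for every $r\geqslant 0$ there exists $y\in Y$ such that $B(y,r)\subseteq Y$; $Y$ is prethick if $B(Y,r)$ is thick for some $r\geqslant 0$. $X$ is endowed with the discrete topology and $\beta X$ is its Stone-Čech compactification, identified with the set of all ultrafilters on $X$; the sets $\{p\in\beta X: A\in p\}$, $A\subseteq X$, form a base of the topology. $X^\#=\{p\in\beta X: \text{each } P\in p \text{ is unbounded in } X\}$, with the subspace topology; $\mathrm{cl}$ denotes closure in $X^\#$. For $p,q\in X^\#$ write $p\parallel q$ if there is $r\geqslant 0$ such that $B(Q,r)\in p$ for each $Q\in q$ (this is an equivalence relation, called parallel equivalence). Put $\overline{\overline{p}}=\{q\in X^\#: p\parallel q\}$. A subset $S\subseteq X^\#$ is invariant if $\overline{\overline{p}}\subseteq S$ for each $p\in S$. A minimal closed invariant subset of $X^\#$ is a subset that is minimal by inclusion among the nonempty closed invariant subsets of $X^\#$. $K(X^\#)=\bigcup\{M: M \text{ is a minimal closed invariant subset of } X^\#\}$. *)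

(* Defs.v *)
From HB Require Import structures.
From mathcomp Require Import all_boot all_order all_algebra.
From mathcomp Require Import all_classical all_reals.
From mathcomp Require Import topology.

Set Implicit Arguments.
Unset Strict Implicit.
Unset Printing Implicit Defensive.

Import Order.TTheory GRing.Theory Num.Theory.

Local Open Scope classical_set_scope.
Local Open Scope ring_scope.

Section Balls.
Context {R : realType} {X : metricType R}.

(* The library's [ball] is the open ball; closed balls are used throughout. *)
Definition cball (x : X) (r : R) : set X := [set y | mdist x y <= r].

Definition set_cball (A : set X) (r : R) : set X := \bigcup_(a in A) cball a r.

Definition mbounded (V : set X) : Prop :=
  exists x : X, exists2 r : R, 0 <= r & V `<=` cball x r.

Definition thick (Y : set X) : Prop :=
  forall r : R, 0 <= r -> exists2 y, Y y & cball y r `<=` Y.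

Definition prethick (Y : set X) : Prop :=
  exists2 r : R, 0 <= r & thick (set_cball Y r).

End Balls.

Record stone_cech (T : Type) := StoneCech {
  ultra_sets :> set T -> Prop ;
  ultra_setsP : UltraFilter ultra_sets }.

#[global] Existing Instance ultra_setsP.

HB.instance Definition _ (T : Type) := gen_eqMixin (stone_cech T).
HB.instance Definition _ (T : Type) := gen_choiceMixin (stone_cech T).

Section StoneCechTopology.
Context {T : Type}.

Definition ultra_basic (A : set T) : set (stone_cech T) := [set p | p A].

Lemma ultra_basic_cover : \bigcup_(A in setT) ultra_basic A = setT.
Proof. by apply/seteqP; split=> // p _; exists setT => //; exact: filterT. Qed.

Lemma ultra_basic_join (A B : set T) (p : stone_cech T) :
  [set: set T] A -> [set: set T] B -> ultra_basic A p -> ultra_basic B p ->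
  exists C, [/\ [set: set T] C, ultra_basic C p &
    ultra_basic C `<=` ultra_basic A `&` ultra_basic B].
Proof.
move=> _ _ pA pB; have pAB : p (A `&` B) by exact: filterI.
exists (A `&` B); split => //.
by move=> q qAB; split; apply: (@filterS _ (ultra_sets q) _ _ _ _ qAB) => x [].
Qed.

HB.instance Definition _ := isBaseTopological.Build (stone_cech T)
  ultra_basic_cover ultra_basic_join.

End StoneCechTopology.

Section Sharp.
Context {R : realType} (X : metricType R).

(* Coerced to a type, [sharp] carries the topology induced by [stone_cech X],
   which only depends on the set [X] and not on its metric topology. *)
Definition sharp : set (stone_cech X) :=
  [set p | forall P : set X, p P -> ~ mbounded P].

Definition parallel (p q : sharp) : Prop :=
  exists2 r : R, 0 <= r &
    forall Q : set X, set_val q Q -> set_val p (set_cball Q r).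

Definition parallel_class (p : sharp) : set sharp := [set q | parallel p q].

Definition invariant_set (S : set sharp) : Prop :=
  forall p, S p -> parallel_class p `<=` S.

Definition closed_invariant (S : set sharp) : Prop :=
  [/\ S !=set0, closed S & invariant_set S].

Definition minimal_closed_invariant (M : set sharp) : Prop :=
  closed_invariant M /\
  forall N : set sharp, closed_invariant N -> N `<=` M -> N = M.

Definition sharpK : set sharp :=
  \bigcup_(M in [set M | minimal_closed_invariant M]) M.

End Sharp.

Arguments sharp {R} X _.
Arguments sharpK {R} X _.

(* Main.v *)
(* If Q is not prethick then, for every r, the complement C_r of B(Q, r) is
   coarsely dense in X, so every closed invariant M contains ultrafilters
   through C_r. By compactness those containing all the C_r form a nonempty
   closed set N in M, and N is invariant since B(B(Q, r), s) is contained in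
   B(Q, r + s). If M is minimal, N = M, so no member of M contains Q.

   Conversely, if Y = B(Q, r) is thick, the ultrafilters in X^# containing
   {y : B(y, s) is contained in Y} for all s form a nonempty closed invariant
   set, which by Zorn's lemma contains a minimal one, M. Pushing p in M forward
   along a map Y -> Q moving points by at most r gives an ultrafilter parallel
   to p, hence in M, which contains Q. *)
Require Import Defs.
From mathcomp Require Import all_boot all_order all_algebra.
From mathcomp Require Import all_classical all_reals.
From mathcomp Require Import topology.

Local Open Scope classical_set_scope.

Import Order.TTheory GRing.Theory Num.Theory.

(** * Images and complements for ultrafilters *)

Lemma ultra_fmap (T U : Type) (f : T -> U) (F : set_system T) :
  UltraFilter F -> UltraFilter (f @ F).
Proof.
move=> FU; split; first exact: fmap_proper_filter.
move=> G GF FG; apply/seteqP; split=> [A GA|]; last exact: FG.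
have [//|FnA] := in_ultra_setVsetC (f @^-1` A) FU.
have GnA : G (~` A) by apply: FG.
by case: (@filter_not_empty _ G GF); rewrite -(setICr A); exact: filterI.
Qed.

Lemma ultra_setC_not (T : Type) (p : stone_cech T) (A : set T) :
  p (~` A) <-> ~ p A.
Proof.
split=> [pnA pA|npA].
  by case: (@filter_not_empty _ p _); rewrite -(setICr A); exact: filterI.
by have [] := in_ultra_setVsetC A (ultra_setsP p).
Qed.

(** * Closed balls and thick sets *)

Section Balls.
Context {R : realType} {X : metricType R}.
Local Open Scope ring_scope.
Implicit Types (x y z : X) (r s : R) (A B Y : set X).

Lemma cball_sym x y r : cball x r y -> cball y r x.
Proof. by rewrite /cball /= metric_sym. Qed.

Lemma cball_triangle {y x z r s} :
  cball x r y -> cball y s z -> cball x (r + s) z.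
Proof.
rewrite /cball /= => xy yz.
exact: le_trans (metric_triangle _ y _) (lerD xy yz).
Qed.

Lemma cball_mono x r s : r <= s -> cball x r `<=` cball x s.
Proof. by move=> rs y; rewrite /cball /= => /le_trans; apply. Qed.

Lemma set_cball_mono A r s : r <= s -> set_cball A r `<=` set_cball A s.
Proof. by move=> rs x [a Aa ax]; exists a => //; exact: cball_mono ax. Qed.

Lemma sub_set_cball A r : 0 <= r -> A `<=` set_cball A r.
Proof. by move=> r0 x Ax; exists x => //; rewrite /cball /= mdistxx. Qed.

Lemma set_cball_set_cball A r s :
  set_cball (set_cball A r) s `<=` set_cball A (r + s).
Proof.
by move=> z [y [x Ax xy] yz]; exists x => //; exact: cball_triangle xy yz.
Qed.

Lemma mbounded_set_cball A r : 0 <= r -> mbounded A -> mbounded (set_cball A r).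
Proof.
move=> r0 [x [s s0 As]]; exists x, (s + r); first exact: addr_ge0.
by move=> z [y /As xy yz]; exact: cball_triangle xy yz.
Qed.

Lemma mbounded_cball0 (x : X) A : mbounded A ->
  exists2 r, 0 <= r & A `<=` cball x r.
Proof.
move=> [y [r r0 Ar]]; exists (mdist x y + r).
  by rewrite addr_ge0 // mdist_ge0.
by move=> z /Ar; apply: cball_triangle; rewrite /cball /=.
Qed.

(** Erosion of [Y] by [r]; thickness of [Y] says that all these sets with [0 <= r] are nonempty. *)
Definition core Y r : set X := [set y | cball y r `<=` Y].

Lemma core_anti Y r s : r <= s -> core Y s `<=` core Y r.
Proof. by move=> rs y Yy z /(@cball_mono _ _ _ rs)/Yy. Qed.

Lemma thick_core_unbounded Y r x s : ~ mbounded [set: X] -> thick Y -> 0 <= r ->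
  0 <= s -> exists y, core Y r y /\ ~ cball x s y.
Proof.
move=> Xunb thY r0 s0.
have [z xz] : exists z, ~ cball x s z.
  by apply/existsNP => xX; apply: Xunb; exists x, s.
have xz0 := mdist_ge0 x z.
(* The radius is large enough that, if [y] falls within [s] of [x], the ball of radius [r] about the
   outside point [z] still lies in [Y]. *)
have [y Yy yY] := thY (s + mdist x z + r) (addr_ge0 (addr_ge0 s0 xz0) r0).
have [xy|nxy] := pselect (cball x s y); last first.
  exists y; split => //; apply: core_anti yY.
  by rewrite lerDr addr_ge0.
exists z; split => // w zw; apply: yY; apply: cball_triangle zw.
by apply: cball_triangle (cball_sym _ _ _ xy) _; rewrite /cball /=.
Qed.

End Balls.

(** * Closure, compactness and parallel ultrafilters in $X^\#$ *)

Section Sharp.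
Context {R : realType} {X : metricType R}.
Local Open Scope ring_scope.
Implicit Types (p q : sharp X) (P Q A B : set X) (S M L : set (sharp X)).

Lemma closure_sharpP S p :
  closure S p <-> forall P, set_val p P -> exists2 s, S s & set_val s P.
Proof.
split=> [clp P pP|pS B].
  have nP : nbhs p [set s : sharp X | set_val s P].
    apply: open_nbhs_nbhs; split => //.
    exists (ultra_basic P) => //; exists [set P]; first by [].
    by rewrite bigcup_set1.
  by have [s [Ss sP]] := clp _ nP; exists s.
(* An open set is the preimage of a union of basic sets; [P] gives one that contains [p]. *)
rewrite nbhsE => -[O [[V [D' _ <-] <-] [P D'P pP]] OB].
have [s Ss sP] := pS P pP; exists s; split => //; apply: OB.
by exists P.
Qed.

Lemma closed_sharp_mem S p : closed S ->
  (forall A, (forall s, S s -> set_val s A) -> set_val p A) -> S p.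
Proof.
move=> clS Sp; apply: clS; apply/closure_sharpP => P pP.
apply: contrapT => /forall2NP nS.
suff /ultra_setC_not : set_val p (~` P) by [].
by apply: Sp => s Ss; apply/ultra_setC_not; have [] := nS s.
Qed.

Lemma ultra_sharp (G : set_system X) : ProperFilter G ->
  (forall P, mbounded P -> G (~` P)) -> exists p, G `<=` set_val p.
Proof.
move=> GF Gb; have [F [FU GsubF]] := ultraFilterLemma GF.
have Fs : sharp X (StoneCech FU).
  move=> P /= FP /Gb/GsubF FnP.
  by case: (@filter_not_empty _ F _); rewrite -(setICr P); exact: filterI.
by exists (SigSub (mem_set Fs)).
Qed.

Lemma sharp_setC_mbounded p P : mbounded P -> set_val p (~` P).
Proof. by move=> bP; apply/ultra_setC_not => /(set_valP p). Qed.

(** Compactness of $X^\#$: the sets common to all members of some [f i] form a proper filter, and an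
    ultrafilter refining it lies in each [f i] by closedness. *)
Lemma directed_bigcap_sharp (I : Type) (D : set I) (f : I -> set (sharp X)) :
  D !=set0 ->
  (forall i, D i -> closed (f i) /\ f i !=set0) ->
  (forall i j, D i -> D j -> exists2 k, D k & f k `<=` f i `&` f j) ->
  \bigcap_(i in D) f i !=set0.
Proof.
move=> [i0 Di0] fD fdir.
pose G := [set A | exists2 i, D i & forall s, f i s -> set_val s A].
have GF : ProperFilter G.
  split; first by move=> [i /fD[_ [s fs]] /(_ s fs)]; exact: filter_not_empty.
  split; first by exists i0 => // s _; exact: filterT.
    move=> A B [i Di iA] [j Dj jB].
    have [k Dk kij] := fdir i j Di Dj; exists k => // s /kij[si sj].
    by apply: filterI; [exact: iA|exact: jB].
  by move=> A B AB [i Di iA]; exists i => // s /iA; exact: filterS.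
have [p Gp] : exists p, G `<=` set_val p.
  apply: ultra_sharp => P bP; exists i0 => // s _.
  exact: sharp_setC_mbounded.
exists p => i Di; apply: closed_sharp_mem (fD i Di).1 _ => A fA.
by apply: Gp; exists i.
Qed.

(** [q] is the image of [p] under a map sending each point of [set_cball P r] to a point of [P] at
    distance at most [r]. A bounded set in [q] would give a bounded one in [p]. *)
Lemma parallel_lift p P r : 0 <= r -> set_val p (set_cball P r) ->
  exists2 q, parallel p q & set_val q P.
Proof.
move=> r0 pP.
have /choice[f fP] (x : X) :
    exists y, set_cball P r x -> P y /\ cball y r x.
  by have [[y Py yx]|nP] := pselect (set_cball P r x); [exists y|exists x].
have FU := @ultra_fmap _ _ f _ (ultra_setsP (set_val p)).
have Fs : sharp X (StoneCech FU).
  move=> Q /= pQ /(mbounded_set_cball _ _ r0) bQ; apply: (set_valP p) bQ.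
  by apply: filterS2 pP pQ => x /fP[_ fx] Qfx; exists (f x).
exists (SigSub (mem_set Fs)); last first.
  by apply: filterS pP => x /fP[].
exists r => // Q pQ.
by apply: filterS2 pP pQ => x /fP[_ fx] Qfx; exists (f x).
Qed.

(** * Minimal sets consist of ultrafilters with prethick members *)

Lemma minimal_closed_invariant_prethick M p Q :
  minimal_closed_invariant M -> M p -> set_val p Q -> prethick Q.
Proof.
move=> [[_ clM invM] minM] Mp pQ; apply: contrapT => nQ.
pose f r := [set m | M m /\ set_val m (~` set_cball Q r)].
have f_mono r s : r <= s -> f s `<=` f r.
  move=> rs m [Mm mQ]; split=> //; apply: filterS mQ.
  exact/subsetC/set_cball_mono.
have f_closed r : closed (f r).
  move=> m /closure_sharpP mf; split.
    by apply: clM; apply/closure_sharpP => P /mf[s [Ms _] sP]; exists s.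
  apply/ultra_setC_not => /mf[s [_ /ultra_setC_not]]; exact.
have f_neq0 r : 0 <= r -> f r !=set0.
  move=> r0; have [s s0 Qs] : exists2 s, 0 <= s &
      forall y, set_cball Q r y -> ~ cball y s `<=` set_cball Q r.
    apply: contrapT => /forall2NP nth; apply: nQ; exists r => // s s0.
    apply: contrapT => /forall2NP ns; have [//|] := nth s; apply => y Qy yQ.
    by have [] := ns y.
  have [q pq qQ] : exists2 q, parallel p q & set_val q (~` set_cball Q r).
    (* By the choice of [s], every point of [X] is within [s] of the complement of
       [set_cball Q r]. *)
    apply: (parallel_lift p _ s) => //; apply: filterS (filterT) => y _.
    have [/Qs/existsNP[z /not_implyP[yz nQz]]|nQy] :=
        pselect (set_cball Q r y); last exact: sub_set_cball.
    by exists z => //; exact: cball_sym.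
  by exists q; split=> //; exact: invM pq.
pose N := \bigcap_(r in [set r : R | 0 <= r]) f r.
have NM : N `<=` M by move=> m /(_ 0 (lexx _))[].
have : closed_invariant N.
  split.
  - apply: directed_bigcap_sharp; first by exists 0 => /=.
      by move=> r /= r0; split; [exact: f_closed|exact: f_neq0].
    move=> r s /= r0 s0; exists (Num.max r s); first by rewrite /= le_max r0.
    by rewrite subsetI; split; apply: f_mono; rewrite le_max lexx ?orbT.
  - by apply: closed_bigI => r _; exact: f_closed.
  - move=> m Nm q mq r /= r0; split; first exact: invM (NM _ Nm) _ mq.
    apply/ultra_setC_not => qQ; case: mq => s s0 /(_ _ qQ) mQ.
    have [_ /ultra_setC_not] := Nm (r + s) (addr_ge0 r0 s0); apply.
    by apply: filterS mQ; exact: set_cball_set_cball.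
move=> /minM/(_ NM) NeM.
have [_ /ultra_setC_not] : f 0 p by rewrite -NeM in Mp; exact: Mp (lexx _).
by apply; apply: filterS pQ; exact: sub_set_cball.
Qed.

(** * Existence of minimal closed invariant sets *)

Lemma minimal_closed_invariant_exists L : closed_invariant L ->
  exists2 M, minimal_closed_invariant M & M `<=` L.
Proof.
move=> [L0 clL invL].
(* Zorn is applied to the sets removed from [L], so that unions of chains become intersections and a
   maximal [A] leaves a minimal remainder. *)
have [F FP Ftot|A [cA maxA]] :=
    @Zorn_bigcup _ [set U | closed_invariant (L `\` U)].
  have [->|/set0P F0] := eqVneq F set0.
    by rewrite /= bigcup_set0 setD0; split.
  have LDF : L `\` \bigcup_(U in F) U = \bigcap_(U in F) (L `\` U).
    case: F0 => U0 FU0; apply/seteqP; split=> [p [Lp np] U FU|p Fp].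
      by split=> // Up; apply: np; exists U.
    by split=> [|[U FU Up]]; [have [] := Fp _ FU0|have [] := Fp _ FU].
  rewrite /= LDF; split.
  - apply: directed_bigcap_sharp => //; first by move=> U /FP[].
    move=> U V FU FV; have [UV|VU] := Ftot U V FU FV.
      by exists V => // p [Lp nV]; split; split=> // /UV.
    by exists U => // p [Lp nU]; split; split=> // /VU.
  - by apply: closed_bigI => U /FP[].
  - by move=> p Fp q pq U FU; have [_ _ /(_ p)] := FP U FU; apply; [exact: Fp|].
exists (L `\` A); last exact: subDsetl.
split=> // N cN NLA; apply: contrapT => nN.
have LN : L `\` ~` N = N.
  by rewrite setDE setCK; apply/setIidPr => p /NLA[].
apply: (maxA (~` N)); last by rewrite /= LN.
split=> [p Ap /NLA[]//|NA]; apply: nN; apply/seteqP; split=> //.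
by move=> p [Lp nAp]; apply: contrapT => /NA.
Qed.

Lemma thick_minimal_closed_invariant Y : ~ mbounded [set: X] -> thick Y ->
  exists2 M, minimal_closed_invariant M & forall p, M p -> set_val p Y.
Proof.
move=> Xunb thY.
pose L := [set p : sharp X | forall r : R, 0 <= r -> set_val p (core Y r)].
have [M mM ML] : exists2 M, minimal_closed_invariant M & M `<=` L.
  apply: minimal_closed_invariant_exists; split.
  (* Removing balls about a fixed [x] from the cores forces every ultrafilter refining [G] into
     $X^\#$. *)
  - have [x _ _] := thY 0 (lexx _).
    pose G := filter_from [set r : R | 0 <= r]
      (fun r => core Y r `&` ~` cball x r).
    have GF : ProperFilter G.
      apply: filter_from_proper.
        apply: filter_from_filter; first by exists 0 => /=.
        move=> r s /= r0 s0; exists (Num.max r s); first by rewrite /= le_max r0.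
        have rm : r <= Num.max r s by rewrite le_max lexx.
        have sm : s <= Num.max r s by rewrite le_max lexx orbT.
        move=> y [Yy xy]; split; split; do ?exact: core_anti Yy.
          by move=> /(cball_mono _ _ _ rm).
        by move=> /(cball_mono _ _ _ sm).
      by move=> r /= r0; exact: thick_core_unbounded.
    have [p Gp] : exists p, G `<=` set_val p.
      apply: ultra_sharp => // P /(mbounded_cball0 x)[r r0 Pr].
      by exists r => // y [_]; exact/subsetC.
    by exists p => r r0; apply: Gp; exists r => // y [].
  - move=> p /closure_sharpP pL r r0; apply: contrapT => /ultra_setC_not.
    by move=> /pL[s /(_ r r0) sY /ultra_setC_not].
  - move=> p Lp q [s s0 pq] r r0; apply: contrapT => /ultra_setC_not.
    move=> /pq pY; have := Lp (s + r) (addr_ge0 s0 r0); apply/ultra_setC_not.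
    (* A point within [s] of the complement of [core Y r] cannot lie in [core Y (s + r)]. *)
    apply: filterS pY => y [z nYz zy] Yy; apply: nYz => w zw; apply: Yy.
    exact: cball_triangle (cball_sym _ _ _ zy) zw.
exists M => // p /ML/(_ 0 (lexx _)); apply: filterS => y; apply.
by rewrite /cball /= mdistxx.
Qed.

End Sharp.

Theorem theorem3p2 (R : realType) (X : metricType R)
    (X_unbounded : ~ mbounded [set: X]) (q : sharp X) :
  closure (sharpK X) q <-> (forall Q : set X, set_val q Q -> prethick Q).
Proof.
rewrite closure_sharpP; split=> [qK Q /qK[p [M mM Mp] pQ]|qpre Q /qpre[r r0]].
  exact: minimal_closed_invariant_prethick mM Mp pQ.
(* [M] may depend on [Q]: the closure only asks for one point of [sharpK X] through each [Q]. *)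
move=> /(thick_minimal_closed_invariant _ X_unbounded)[M mM MQ].
have [[[p Mp] _ invM] _] := mM.
have [p' pp' p'Q] := parallel_lift _ _ _ r0 (MQ p Mp).
by exists p' => //; exists M => //; exact: invM pp'.
Qed.
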